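(* In the preemptive FIFO buffer management problem, let $B$ be an arbitrary initial buffer and let $B'=\emptyset$ be the empty buffer. For an input sequence $\sigma$, let $v(\mathrm{OPT}(B,\sigma))$ denote the total value transmitted by the optimal schedule operating on input $\sigma$ starting from buffer $B$ (and similarly for $B'$). Then $$v(\mathrm{OPT}(B',\sigma))-\varepsilon\ \le\ v(\mathrm{OPT}(B,\sigma))\ \le\ v(\mathrm{OPT}(B',\sigma))+\varepsilon,$$ where $\varepsilon=|v(B)-v(B')|=v(B)$ is the total value of the packets in the initial buffer $B$.
   Context: Preemptive FIFO buffer management. A buffer has fixed finite capacity. Time is discrete, $i\in\{1,\dots,T\}$. An input is $\sigma=(\sigma_1,\dots,\sigma_T)$, where $\sigma_i=(p_{i_1},\dots,p_{i_k})$, $k\in\mathbb{Z}_+$, is the sequence of packets arriving at step $i$; each packet $p$ has a nonnegative real value $v(p)$. Each step has two phases. Arrival phase: for each arriving packet in turn, the algorithm immediately accepts or drops it, and it may preempt (permanently discard) any packets in the buffer; an accepted packet is placed at the tail of the buffer, and the capacity may never be exceeded. Transmission phase: after all arrivals of the step, the packet at the head of the buffer (if any) is transmitted and its value is gained. A buffer state $B$ is a FIFO-ordered list of packets respecting the capacity, with total value $v(B)=\sum_{p\in B}v(p)$. Starting from $B$ means that before step 1 the buffer contains $B$; its packets may be transmitted (counting toward the transmitted value) or preempted like any others. $\mathrm{OPT}(B,\sigma)$ is an offline optimal schedule (maximum total transmitted value) on $\sigma$ starting from $B$. *)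

(* Defs.v *)
From mathcomp Require Import all_boot all_order all_algebra.
From mathcomp Require Import reals.

Set Implicit Arguments.
Unset Strict Implicit.
Unset Printing Implicit Defensive.

Import Order.TTheory GRing.Theory Num.Theory.
Local Open Scope ring_scope.

(* A buffer is a list of packets, head first; an input is the list, over the
   time steps, of the lists of packets arriving at that step.  A decision on
   one arriving packet is a pair (keep, accept): [keep] is a bit mask selecting
   the buffered packets that are not preempted, and [accept] tells whether the
   arriving packet is placed at the tail.  Packets are designated by their
   position, so repeated elements of [P] in a list are distinct packets. *)
Definition decision : Type := (bitseq * bool)%type.
Definition schedule : Type := seq (seq decision).

Section Buffer.
Variables (R : realType) (P : Type) (v : P -> R) (K : nat).

Definition total_value (b : seq P) : R := \sum_(p <- b) v p.

(* Preemption comes before acceptance: accepting a packet and preempting it at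
   once is the same as dropping it. *)
Definition receive (b : seq P) (p : P) (d : decision) : seq P :=
  if d.2 then rcons (mask d.1 b) p else mask d.1 b.

Definition admissible (b : seq P) (p : P) (d : decision) : bool :=
  (size d.1 == size b) && (size (receive b p d) <= K)%N.

(* [None] signals an inadmissible decision, or a number of decisions that
   differs from the number of arriving packets (likewise in [run]). *)
Fixpoint arrival_phase (b : seq P) (ps : seq P) (ds : seq decision) :
    option (seq P) :=
  match ps, ds with
  | [::], [::] => Some b
  | p :: ps', d :: ds' =>
      if admissible b p d then arrival_phase (receive b p d) ps' ds' else None
  | _, _ => None
  end.

(* The packets transmitted by schedule [s], in order of transmission: after
   each arrival phase the head of the buffer, if any, leaves. *)
Fixpoint run (b : seq P) (sigma : seq (seq P)) (s : schedule) :
    option (seq P) :=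
  match sigma, s with
  | [::], [::] => Some [::]
  | ps :: sigma', ds :: s1 =>
      if arrival_phase b ps ds is Some b1
      then omap (cat (take 1 b1)) (run (behead b1) sigma' s1)
      else None
  | _, _ => None
  end.

Definition feasible (B : seq P) (sigma : seq (seq P)) (s : schedule) : bool :=
  run B sigma s.

Definition schedule_value (B : seq P) (sigma : seq (seq P)) (s : schedule) : R :=
  total_value (odflt [::] (run B sigma s)).

Definition optimal (B : seq P) (sigma : seq (seq P)) (s : schedule) : Prop :=
  feasible B sigma s /\
  forall s1, feasible B sigma s1 ->
    schedule_value B sigma s1 <= schedule_value B sigma s.

(* [schedules b sigma] is a finite list containing every feasible schedule; it
   only serves to prove that an optimal schedule exists. *)
Definition decisions (n : nat) : seq decision :=
  [seq (m, a) | m <- [seq val t | t <- enum {: n.-tuple bool}],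
                a <- [:: true; false]].

Lemma decisionsP n (d : decision) : size d.1 = n -> d \in decisions n.
Proof.
case: d => m a /= sz; apply/allpairsP; exists (m, a) => /=; split => //.
  apply/mapP; exists (Tuple (introT eqP sz)) => //; exact: mem_enum.
by case: a.
Qed.

Fixpoint phases (b ps : seq P) : seq (seq decision) :=
  if ps is p :: ps' then
    [seq d :: ds | d <- decisions (size b), ds <- phases (receive b p d) ps']
  else [:: [::]].

Lemma phasesP b ps ds : arrival_phase b ps ds -> ds \in phases b ps.
Proof.
elim: ps b ds => [|p ps IH] b [|d ds] //=.
case: ifP => // /andP[/eqP sz _] /IH h.
by apply/allpairsPdep; exists d, ds; split => //; apply: decisionsP.
Qed.

Fixpoint schedules (b : seq P) (sigma : seq (seq P)) : seq schedule :=
  if sigma is ps :: sigma' then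
    [seq ds :: s | ds <- phases b ps,
       s <- schedules (behead (odflt [::] (arrival_phase b ps ds))) sigma']
  else [:: [::]].

Lemma schedulesP b sigma s : feasible b sigma s -> s \in schedules b sigma.
Proof.
rewrite /feasible; elim: sigma b s => [|ps sigma IH] b [|ds s] //=.
case E: (arrival_phase b ps ds) => [b1|] //.
case E': (run (behead b1) sigma s) => [t|] // _.
apply/allpairsPdep; exists ds, s; split => //; first by apply: phasesP; rewrite E.
by rewrite E /=; apply: IH; rewrite E'.
Qed.

Lemma feasible_exists b sigma : {s | feasible b sigma s}.
Proof.
rewrite /feasible; elim: sigma b => [|ps sigma IH] b; first by exists [::].
have [ds [b1 E]] : {ds & {b1 | arrival_phase b ps ds = Some b1}}.
  elim: ps b => [|p ps IHp] b; first by exists [::], b.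
  have [ds [b1 E]] := IHp [::].
  exists ((nseq (size b) false, false) :: ds), b1.
  by rewrite /= /admissible /receive /= size_nseq eqxx mask_false leq0n.
have [s] := IH (behead b1); case E': (run _ _ _) => [t|] // _.
by exists (ds :: s); rewrite /= E E'.
Qed.

Lemma argmax_seq (A : eqType) (f : A -> R) (x : A) (s : seq A) :
  {y | y \in x :: s & forall z, z \in x :: s -> f z <= f y}.
Proof.
elim: s x => [|a s IH] x.
  by exists x; rewrite ?mem_head // => z; rewrite inE => /eqP ->.
have [y ys ymax] := IH a; case: (leP (f y) (f x)) => h.
  exists x; first exact: mem_head.
  move=> z; rewrite inE => /orP[/eqP -> //|/ymax zy]; exact: le_trans zy h.
exists y; first by rewrite inE ys orbT.
by move=> z; rewrite inE => /orP[/eqP ->|/ymax //]; apply: ltW.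
Qed.

Lemma optimal_exists (B : seq P) (sigma : seq (seq P)) :
  {s | optimal B sigma s}.
Proof.
have [s0 s0f] := feasible_exists B sigma.
have [s] := argmax_seq (schedule_value B sigma) s0
  [seq s <- schedules B sigma | feasible B sigma s].
move=> s_in s_max; exists s; split.
  by move: s_in; rewrite inE mem_filter => /orP[/eqP ->|/andP[]].
move=> s1 s1f; apply: s_max.
by rewrite inE mem_filter s1f schedulesP ?orbT.
Qed.

Definition OPT (B : seq P) (sigma : seq (seq P)) : schedule :=
  sval (optimal_exists B sigma).

Lemma OPT_optimal (B : seq P) (sigma : seq (seq P)) :
  optimal B sigma (OPT B sigma).
Proof. exact: svalP (optimal_exists B sigma). Qed.

Definition OPT_value (B : seq P) (sigma : seq (seq P)) : R :=
  schedule_value B sigma (OPT B sigma).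

End Buffer.

(* Main.v *)
(* Neither schedule loses much by simulating the other.  Starting from [B], one
   can copy any schedule for the empty buffer: the packets of [B] that have not
   left yet are all preempted when the first packet arrives, and until then the
   empty buffer gains nothing.  Conversely, a schedule whose buffer is [x ++ c]
   can be copied from its suffix [c]: it transmits every packet of [c] that the
   original transmits, possibly earlier, so only the value of [x] can be lost.
   A transmission moves the head of [c] from [c] to [x]. *)
Require Import Defs.
From mathcomp Require Import all_boot all_order all_algebra.
From mathcomp Require Import reals.

Set Implicit Arguments.
Unset Strict Implicit.
Unset Printing Implicit Defensive.

Import Order.TTheory GRing.Theory Num.Theory.
Local Open Scope ring_scope.

Section Simulation.
Variables (R : realType) (P : Type) (v : P -> R) (K : nat).
Hypothesis v_ge0 : forall p : P, 0 <= v p.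
Implicit Types (b c x ps t : seq P) (sigma : seq (seq P)) (s : schedule).

Lemma total_value_cat b c :
  total_value v (b ++ c) = total_value v b + total_value v c.
Proof. exact: big_cat. Qed.

Lemma total_value_cons p b : total_value v (p :: b) = v p + total_value v b.
Proof. exact: big_cons. Qed.

Lemma total_value_ge0 b : 0 <= total_value v b.
Proof. exact: sumr_ge0. Qed.

Lemma total_value_mask m b : total_value v (mask m b) <= total_value v b.
Proof.
elim: b m => [|p b IH] [|[] m] //=; rewrite ?total_value_cons.
- by rewrite [leLHS]big_nil addr_ge0 ?total_value_ge0.
- by rewrite lerD2l.
- by rewrite -[leLHS]add0r lerD.
Qed.

Lemma run_from_empty_simulated b sigma s t :
  run K [::] sigma s = Some t ->
  exists s' t',
    run K b sigma s' = Some t' /\ total_value v t <= total_value v t'.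
Proof.
elim: sigma b s t => [|[|p ps] sigma IH] b [|[|d ds] s] t //=.
- by move=> [<-]; exists [::], [::].
- case E: (run K [::] sigma s) => [t1|] //= [<-].
  have [s' [t' [E' le]]] := IH (behead b) _ _ E.
  exists ([::] :: s'), (take 1 b ++ t'); rewrite /= E'; split=> //.
  by rewrite total_value_cat (le_trans le) // lerDr total_value_ge0.
- case: ifP => // /andP[_ cap].
  case E: arrival_phase => [b1|] //; case E1: run => [t1|] //= [<-].
  (* The all-false mask empties [b] before [p] is handled, so both buffers coincide from here on and
     the remaining decisions are copied verbatim. *)
  exists (((nseq (size b) false, d.2) :: ds) :: s), (take 1 b1 ++ t1).
  have Er : receive b p (nseq (size b) false, d.2) = receive [::] p d.
    by rewrite /receive /= mask_false mask0.
  by rewrite /= /admissible Er /= size_nseq eqxx cap E /= E1.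
Qed.

(** Each mask splits at [size x]: its first part can only shrink [x], its second part is the
    decision to copy on [c]. The copy holds fewer packets, so it respects the capacity. *)
Lemma arrival_phase_suffix x c ps ds b1 :
  arrival_phase K (x ++ c) ps ds = Some b1 ->
  exists ds' x1 c1,
    [/\ arrival_phase K c ps ds' = Some c1, b1 = x1 ++ c1
      & total_value v x1 <= total_value v x].
Proof.
elim: ps x c ds => [|p ps IH] x c [|[m a] ds] //=.
  by move=> [<-]; exists [::], x, c.
case: ifP => // /andP[/eqP sz cap].
pose m1 := take (size x) m; pose m2 := drop (size x) m.
have sz1 : size m1 = size x.
  by apply: size_takel; rewrite sz size_cat leq_addr.
have sz2 : size m2 = size c by rewrite size_drop sz size_cat addKn.
have Er : receive (x ++ c) p (m, a) = mask m1 x ++ receive c p (m2, a).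
  rewrite /receive /= -[m in LHS](cat_take_drop (size x)) mask_cat //.
  by case: (a); rewrite ?rcons_cat.
rewrite Er => /IH[ds' [x1 [c1 [E -> le]]]].
exists ((m2, a) :: ds'), x1, c1; split=> //.
  rewrite /= /admissible /= sz2 eqxx /= ifT // (leq_trans _ cap) //.
  by rewrite Er size_cat leq_addl.
exact: le_trans le (total_value_mask _ _).
Qed.

Lemma run_suffix x c sigma s t :
  run K (x ++ c) sigma s = Some t ->
  exists s' t', run K c sigma s' = Some t' /\
    total_value v t <= total_value v x + total_value v t'.
Proof.
elim: sigma x c s t => [|ps sigma IH] x c [|ds s] t //=.
  move=> [<-]; exists [::], [::]; split=> //.
  by rewrite lerDr total_value_ge0.
case Ea: arrival_phase => [b1|] //.
have [ds' [x1 [c1 [Ec -> lex]]]] := arrival_phase_suffix Ea.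
case E: run => [t1|] //= [<-].
suff [s' [t' [E' le]]] : exists s' t', run K (behead c1) sigma s' = Some t' /\
    total_value v (take 1 (x1 ++ c1) ++ t1) <=
    total_value v x1 + total_value v (take 1 c1 ++ t').
  exists (ds' :: s'), (take 1 c1 ++ t'); rewrite /= Ec E'; split=> //.
  by rewrite (le_trans le) // lerD2r.
(* With an empty prefix, both runs transmit the same packet, if any, and the prefix stays empty. *)
case: x1 E {lex} => [|h x1] /= E.
  have [s' [t' [E' le]]] := IH [::] _ _ _ E.
  exists s', t'; split=> //; move: le.
  by rewrite !total_value_cat [total_value v [::]]big_nil !add0r lerD2l.
(* Here the original transmits [h], paid for by the prefix, while the copy transmits the head of
   [c1]. That packet joins the prefix, which repays its value; [take 1] also covers an empty
   [c1]. *)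
have Eb : x1 ++ c1 = (x1 ++ take 1 c1) ++ behead c1.
  by rewrite -catA -drop1 cat_take_drop.
rewrite Eb in E; have [s' [t' [E' le]]] := IH _ _ _ _ E.
exists s', t'; split=> //; move: le.
by rewrite take0 /= !total_value_cons !total_value_cat -!addrA lerD2l.
Qed.

(** The hypothesis is applied to the optimal schedule from [b]; the optimum from [c] dominates its
    simulation. *)
Lemma OPT_value_le b c sigma e :
  (forall s t, run K b sigma s = Some t ->
    exists s' t', run K c sigma s' = Some t' /\
      total_value v t <= e + total_value v t') ->
  OPT_value v K b sigma <= e + OPT_value v K c sigma.
Proof.
have [+ _] := OPT_optimal v K b sigma; have [_ max] := OPT_optimal v K c sigma.
rewrite /OPT_value /feasible {1}/schedule_value.
case E: run => [t|] // _ /(_ _ _ E)[s' [t' [E' le]]].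
have := max s'; rewrite /feasible E' => /(_ isT).
by rewrite {1}/schedule_value E' /= => le'; rewrite (le_trans le) // lerD2l.
Qed.

End Simulation.

Theorem lemma10 (R : realType) (P : Type) (v : P -> R) (K : nat)
    (v_ge0 : forall p : P, 0 <= v p)
    (B : seq P) (B_cap : (size B <= K)%N) (sigma : seq (seq P)) :
  let B' : seq P := [::] in
  let eps : R := `|total_value v B - total_value v B'| in
  [/\ eps = total_value v B,
      OPT_value v K B' sigma - eps <= OPT_value v K B sigma
    & OPT_value v K B sigma <= OPT_value v K B' sigma + eps].
Proof.
move=> B' eps.
have Eeps : eps = total_value v B.
  by rewrite /eps [total_value v B']big_nil subr0 ger0_norm ?total_value_ge0.
split=> //; rewrite Eeps.
- rewrite lerBlDl; apply: OPT_value_le => s t /(run_from_empty_simulated v_ge0 B).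
  move=> [s' [t' [E le]]]; exists s', t'; split=> //.
  by rewrite (le_trans le) // lerDr total_value_ge0.
(* Reading [B] as [B ++ [::]] makes the whole buffer the prefix. *)
- rewrite addrC; apply: OPT_value_le => s t E.
  by apply: (@run_suffix _ _ _ _ v_ge0 B [::] _ s); rewrite cats0.
Qed.
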